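(* Let $\mathrm{M}$ be a matroid on a finite ground set and let $K<L$ be flats of $\mathrm{M}$. Then $\mathrm{vol}_K^L=\mathrm{pol}_K^L$ as polynomials in the variables $t_F$, $F$ a flat with $K<F<L$, where $\mathrm{vol}_K^L$ is the volume polynomial of the Chow ring $A_K^L$ and $\mathrm{pol}_K^L$ is the recursively defined polynomial attached to the interval $[K,L]$ of the lattice of flats $\mathscr{P}$ of $\mathrm{M}$.
   Context: Throughout $\subset$ denotes strict inclusion, $\mathscr{P}$ is the lattice of flats of $\mathrm{M}$ ordered by inclusion, $<$ and $\prec$ are the order and cover relations of $\mathscr{P}$; $r(K,L)$ is the rank (length of a maximal chain) of $[K,L]$ in $\mathscr{P}$ and $d(K,L)=r(K,L)-1$. The polynomials $\mathrm{pol}_K^L$: for finite sets $K\subset L$ let $\mathscr{E}_K^L=\{(y_S)_{K\subset S\subset L}:y_S\in\mathbb{R}\}$, indexed by all sets $S$ strictly between $K$ and $L$. For $K\subseteq F\subset G\subseteq L$ define the linear map $\pi_F^G:\mathscr{E}_K^L\to\mathscr{E}_F^G$ by $$\pi_F^G(\mathbf{t})=\Big(t_S-t_G\frac{|S\setminus F|}{|G\setminus F|}-t_F\frac{|G\setminus S|}{|G\setminus F|}\Big)_{F\subset S\subset G},\qquad t_K=t_L=0.$$ For flats $K<L$ the polynomial $\mathrm{pol}_K^L(\mathbf{t})$ in the variables $\{t_F:F\in\mathscr{P},K<F<L\}$ is defined recursively by $\mathrm{pol}_K^L=1$ if $d(K,L)=0$, and if $d(K,L)\ge1$, $$d(K,L)\cdot\mathrm{pol}_K^L(\mathbf{t})=\sum_{F\in\mathscr{P},\,K<F<L}t_F\cdot\mathrm{pol}_K^F(\pi_K^F(\mathbf{t}))\cdot\mathrm{pol}_F^L(\pi_F^L(\mathbf{t})).$$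 Chow ring: $A_K^L=\mathbb{R}[x_F:F\in\mathscr{P},K<F<L]/(I+J)$, where $I$ is the ideal generated by all monomials $x_Fx_G$ with $F,G$ non-comparable flats strictly between $K$ and $L$, and $J$ is the ideal generated by the linear forms $\sum_{F\ni i}x_F-\sum_{F\ni j}x_F$ for distinct $i,j\in L\setminus K$ (sums over flats $F$ with $K<F<L$). It is graded, $A_K^L=\bigoplus_{k=0}^d(A_K^L)_k$ with $d=d(K,L)$, and it is a known fact (Adiprasito–Huh–Katz) that there is a well-defined linear isomorphism $\deg:(A_K^L)_d\to\mathbb{R}$ with $\deg(x_{F_1}x_{F_2}\cdots x_{F_d})=1$ for every maximal flag of flats $K\prec F_1\prec\cdots\prec F_d\prec L$. Volume polynomial: $\mathrm{vol}_K^L(\mathbf{t})=\frac{1}{d!}\deg\Big(\big(\sum_{K<F<L}x_Ft_F\big)^d\Big)$, $d=d(K,L)$, where $\deg$ is extended linearly to coefficients in $\mathbb{R}[\mathbf{t}]$. *)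

(* Defs.v *)
From HB Require Import structures.
From mathcomp Require Import all_boot all_order all_algebra.
From mathcomp Require Import generic_quotient ring_quotient.
From mathcomp Require Import boolp reals.
From mathcomp Require Import mpoly.

Set Implicit Arguments.
Unset Strict Implicit.
Unset Printing Implicit Defensive.

Import Order.TTheory GRing.Theory Num.Theory.
Local Open Scope ring_scope.
Local Open Scope quotient_scope.

Record matroid (E : finType) := Matroid {
  indep : {set {set E}};
  indep_set0 : set0 \in indep;
  indep_sub : forall A B : {set E}, A \subset B -> B \in indep -> A \in indep;
  indep_aug : forall A B : {set E}, A \in indep -> B \in indep -> (#|A| < #|B|)%N ->
    exists2 x, x \in B :\: A & x |: A \in indep
}.

Definition mrank (E : finType) (M : matroid E) (A : {set E}) : nat :=
  \max_(B in indep M | B \subset A) #|B|.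

Definition flat (E : finType) (M : matroid E) (F : {set E}) : bool :=
  [forall x, (x \notin F) ==> (mrank M F < mrank M (x |: F))%N].

Definition between (E : finType) (M : matroid E) (K L F : {set E}) : bool :=
  [&& flat M F, K \proper F & F \proper L].

Definition covers (E : finType) (M : matroid E) (F G : {set E}) : bool :=
  [&& flat M F, flat M G, F \proper G & ~~ [exists H, between M F G H]].

Definition flat_chain (E : finType) (M : matroid E) (K L : {set E})
    (C : {set {set E}}) : bool :=
  [forall F in C, [&& flat M F, K \subset F & F \subset L]] &&
  [forall F in C, forall G in C, (F \subset G) || (G \subset F)].

(* The length of a chain is the number of its elements minus one; all the
   maximal chains of an interval of a lattice of flats have the same length. *)
Definition flat_rk (E : finType) (M : matroid E) (K L : {set E}) : nat :=
  \max_(C | flat_chain M K L C) #|C|.-1.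

Definition flat_d (E : finType) (M : matroid E) (K L : {set E}) : nat :=
  (flat_rk M K L).-1.

Definition btw (E : finType) (M : matroid E) (K L : {set E}) : finType :=
  {F : {set E} | between M K L F}.

Definition nbtw (E : finType) (M : matroid E) (K L : {set E}) : nat :=
  #|btw M K L|.

(* [{mpoly A[nbtw M K L]}] is the polynomial ring over [A] in the variables
   [tvar F], [F] a flat with [K < F < L].  For any other set [F], [tvar F] is
   0; in particular [t_K = t_L = 0]. *)
Definition tvar (A : nzRingType) (E : finType) (M : matroid E)
    (K L F : {set E}) : {mpoly A[nbtw M K L]} :=
  if insub F is Some u then 'X_(enum_rank (u : btw M K L)) else 0.

Definition btw_set (E : finType) (M : matroid E) (K L : {set E})
    (i : 'I_(nbtw M K L)) : {set E} :=
  val (enum_val i : btw M K L).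

(* The coordinates of [t] are taken in an arbitrary [R]-module, so that [t]
   may be a real vector as well as a vector of linear forms. *)
Definition piFG (R : realType) (E : finType) (V : lmodType R) (F G : {set E})
    (t : {set E} -> V) (S : {set E}) : V :=
  t S - (#|S :\: F|%:R / #|G :\: F|%:R) *: t G
      - (#|G :\: S|%:R / #|G :\: F|%:R) *: t F.

(* [psubst t p] is [p(t)]: each variable [t_F] of [p] is replaced by [t F]. *)
Definition psubst (R : realType) (E : finType) (M : matroid E)
    (K L : {set E}) (k : nat) (t : {set E} -> {mpoly R[k]})
    (p : {mpoly R[nbtw M K L]}) : {mpoly R[k]} :=
  p \mPo [tuple t (btw_set i) | i < nbtw M K L].

(* The first argument only bounds the depth of the recursion; [polE] below is
   the recursive equation satisfied by [pol]. *)
Fixpoint pol_rec (R : realType) (E : finType) (M : matroid E) (n : nat)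
    (K L : {set E}) : {mpoly R[nbtw M K L]} :=
  if n is n'.+1 then
    if flat_d M K L == 0%N then 1 else
    (flat_d M K L)%:R^-1 *:
      \sum_(F : {set E} | between M K L F)
        tvar R M K L F
        * psubst (piFG K F (tvar R M K L)) (pol_rec R M n' K F)
        * psubst (piFG F L (tvar R M K L)) (pol_rec R M n' F L)
  else 1.

Definition pol (R : realType) (E : finType) (M : matroid E) (K L : {set E}) :
    {mpoly R[nbtw M K L]} :=
  pol_rec R M #|L :\: K| K L.

Lemma between_card (E : finType) (M : matroid E) (K L F : {set E}) :
  between M K L F ->
  (#|F :\: K| < #|L :\: K|)%N /\ (#|L :\: F| < #|L :\: K|)%N.
Proof.
case/and3P=> _ KF FL; have [sKF sFL] := (proper_sub KF, proper_sub FL).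
have sKL := subset_trans sKF sFL.
have hKF := proper_card KF; have hFL := proper_card FL.
rewrite !cardsDS //; split; first by rewrite ltn_sub2r // (ltn_trans hKF).
by rewrite ltn_sub2l // (ltn_trans hKF).
Qed.

Lemma proper_setD_gt0 (E : finType) (A B : {set E}) :
  A \proper B -> (0 < #|B :\: A|)%N.
Proof. by rewrite card_gt0 setD_eq0 => /andP[]. Qed.

Lemma pol_recS (R : realType) (E : finType) (M : matroid E) (n : nat)
    (K L : {set E}) :
  pol_rec R M n.+1 K L =
    if flat_d M K L == 0%N then 1 else
    (flat_d M K L)%:R^-1 *:
      \sum_(F : {set E} | between M K L F)
        tvar R M K L F
        * psubst (piFG K F (tvar R M K L)) (pol_rec R M n K F)
        * psubst (piFG F L (tvar R M K L)) (pol_rec R M n F L).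
Proof. by []. Qed.

Lemma pol_rec_stable (R : realType) (E : finType) (M : matroid E) (m n : nat)
    (K L : {set E}) :
  (0 < #|L :\: K|)%N -> (#|L :\: K| <= m)%N -> (#|L :\: K| <= n)%N ->
  pol_rec R M m K L = pol_rec R M n K L.
Proof.
elim: m n K L => [|m IH] [|n] K L h hm hn.
- by move: h; rewrite ltnNge hm.
- by move: h; rewrite ltnNge hm.
- by move: h; rewrite ltnNge hn.
rewrite !pol_recS; case: (flat_d M K L == 0%N); first by [].
apply: (congr1 (fun p => _ *: p)); apply: eq_bigr => F bF.
have [_ /proper_setD_gt0 KF /proper_setD_gt0 FL] := and3P bF.
have [lF rF] := between_card bF.
rewrite (IH n K F) ?(IH n F L) // -ltnS.
- exact: leq_trans rF hm.
- exact: leq_trans rF hn.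
- exact: leq_trans lF hm.
- exact: leq_trans lF hn.
Qed.

Lemma polE (R : realType) (E : finType) (M : matroid E) (K L : {set E}) :
  K \proper L ->
  pol R M K L =
    if flat_d M K L == 0%N then 1 else
    (flat_d M K L)%:R^-1 *:
      \sum_(F : {set E} | between M K L F)
        tvar R M K L F
        * psubst (piFG K F (tvar R M K L)) (pol R M K F)
        * psubst (piFG F L (tvar R M K L)) (pol R M F L).
Proof.
move=> KL; rewrite {1}/pol; case En: #|L :\: K| => [|n].
  by have := proper_setD_gt0 KL; rewrite En.
rewrite pol_recS; case: (flat_d M K L == 0%N); first by [].
apply: (congr1 (fun p => _ *: p)); apply: eq_bigr => F bF.
have [_ /proper_setD_gt0 KF /proper_setD_gt0 FL] := and3P bF.
have [] := between_card bF; rewrite En !ltnS => lF rF.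
have EF : pol_rec R M n K F = pol R M K F by apply: pol_rec_stable.
have EL : pol_rec R M n F L = pol R M F L by apply: pol_rec_stable.
by rewrite EF EL.
Qed.

Section Chow.
Variables (R : realType) (E : finType) (M : matroid E) (K L : {set E}).
Local Notation P := {mpoly R[nbtw M K L]}.
Local Notation x := (tvar R M K L).

Definition ideal_gen (G : P -> Prop) (p : P) : Prop :=
  exists s : seq (P * P),
    (forall u, u \in s -> G u.2) /\ p = \sum_(u <- s) u.1 * u.2.

Definition chow_gensI (p : P) : Prop :=
  exists F G, [/\ between M K L F, between M K L G,
    ~~ (F \subset G), ~~ (G \subset F) & p = x F * x G].

Definition chow_gensJ (p : P) : Prop :=
  exists i j, [/\ i \in L :\: K, j \in L :\: K, i != j &
    p = \sum_(F : {set E} | between M K L F && (i \in F)) x F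
      - \sum_(F : {set E} | between M K L F && (j \in F)) x F].

Definition chow_ideal : {pred P} := fun p =>
  `[< exists a b, [/\ ideal_gen chow_gensI a, ideal_gen chow_gensJ b
                    & p = a + b] >].

Lemma ideal_gen0 G : ideal_gen G 0.
Proof. by exists [::]; split=> //; rewrite big_nil. Qed.

Lemma ideal_genMD G p a b :
  ideal_gen G a -> ideal_gen G b -> ideal_gen G (p * a + b).
Proof.
case=> [s [hs ->]] [t [ht ->]].
exists ([seq (p * u.1, u.2) | u <- s] ++ t); split.
  by move=> u; rewrite mem_cat => /orP[/mapP[v vs ->] | ut];
    [exact: (hs v vs) | exact: (ht u ut)].
rewrite big_cat big_map mulr_sumr /=; congr (_ + _).
by apply: eq_bigr => u _; rewrite mulrA.
Qed.

Lemma tvar_const0 F : (x F)@_0%MM = 0.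
Proof.
rewrite /tvar; case: insubP => [u _ _|_]; last by rewrite mcoeff0.
by rewrite mcoeffX mnm1_eq0.
Qed.

Lemma ideal_gen_const0 G p :
  (forall q, G q -> q@_0%MM = 0) -> ideal_gen G p -> p@_0%MM = 0.
Proof.
move=> h [s [hs ->]]; rewrite raddf_sum big_seq big1 // => u /hs /h hu /=.
by rewrite rmorphM /= [X in _ * X]hu mulr0.
Qed.

Lemma chow_ideal_closed : idealr_closed chow_ideal.
Proof.
split.
- by apply/asboolP; exists 0, 0; split; rewrite ?addr0 //; apply: ideal_gen0.
- apply/negP => /asboolP[a [b [Ia Jb]]] /(congr1 (mcoeff 0%MM)).
  have a0 : a@_0%MM = 0.
    apply: ideal_gen_const0 Ia => _ [F [G [_ _ _ _ ->]]].
    by rewrite rmorphM /= !tvar_const0 mulr0.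
  have b0 : b@_0%MM = 0.
    apply: ideal_gen_const0 Jb => _ [i [j [_ _ _ ->]]].
    have s0 (Q : pred {set E}) : (\sum_(F | Q F) x F)@_0%MM = 0.
      by rewrite raddf_sum big1 //= => F _; apply: tvar_const0.
    by rewrite raddfB /= !s0 subrr.
  rewrite raddfD mcoeff1 eqxx; move: a0 b0 => /= -> ->.
  by move/eqP; rewrite addr0 oner_eq0.
- move=> p u v /asboolP[a [b [Ia Jb ->]]] /asboolP[a' [b' [Ia' Jb' ->]]].
  apply/asboolP; exists (p * a + a'), (p * b + b').
  by split; rewrite ?mulrDr 1?addrACA //; apply: ideal_genMD.
Qed.

HB.instance Definition _ := isIdealr.Build P chow_ideal chow_ideal_closed.

Definition chow : Type := {ideal_quot chow_ideal}.
HB.instance Definition _ := GRing.ComNzRing.on chow.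

Definition chow_proj (p : P) : chow := \pi_{ideal_quot chow_ideal} p.

Definition chow_scale (c : R) (a : chow) : chow := chow_proj c%:MP * a.

Lemma chow_projD : {morph chow_proj : p q / p + q}.
Proof. exact: (rmorphD (\pi_{ideal_quot chow_ideal})). Qed.
Lemma chow_projM : {morph chow_proj : p q / p * q}.
Proof. exact: (rmorphM (\pi_{ideal_quot chow_ideal})). Qed.
Lemma chow_proj1 : chow_proj 1 = 1.
Proof. exact: (rmorph1 (\pi_{ideal_quot chow_ideal})). Qed.

Lemma chow_scaleA (c e : R) (a : chow) :
  chow_scale c (chow_scale e a) = chow_scale (c * e) a.
Proof. by rewrite /chow_scale mulrA -chow_projM -mpolyCM. Qed.
Lemma chow_scale1 : left_id 1 chow_scale.
Proof. by move=> a; rewrite /chow_scale chow_proj1 mul1r. Qed.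
Lemma chow_scaleDr : right_distributive chow_scale +%R.
Proof. by move=> c a b; rewrite /chow_scale mulrDr. Qed.
Lemma chow_scaleDl (a : chow) : {morph chow_scale^~ a : c e / c + e}.
Proof. by move=> c e; rewrite /chow_scale mpolyCD chow_projD mulrDl. Qed.

HB.instance Definition _ := GRing.Zmodule_isLmodule.Build R chow
  chow_scaleA chow_scale1 chow_scaleDr chow_scaleDl.

Lemma chow_scaleAl (c : R) (a b : chow) : c *: (a * b) = (c *: a) * b.
Proof. exact: mulrA. Qed.

HB.instance Definition _ := GRing.Lmodule_isLalgebra.Build R chow chow_scaleAl.

Definition chow_var (F : {set E}) : chow := chow_proj (x F).

Definition chow_graded (k : nat) (a : chow) : Prop :=
  exists2 p : P, p \is k.-homog & a = chow_proj p.

Local Notation d := (flat_d M K L).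

(* [deg] is a total function on the Chow ring, but only its restriction to the
   graded piece of degree [d] is meaningful.  That such a map exists is a
   theorem of Adiprasito, Huh and Katz; on that piece it is unique. *)
Record is_degree_map (deg : chow -> R) : Prop := IsDegreeMap {
  degree_map_linear : forall (c : R) (a b : chow),
    chow_graded d a -> chow_graded d b -> deg (c *: a + b) = c * deg a + deg b;
  degree_map_inj : forall a b : chow,
    chow_graded d a -> chow_graded d b -> deg a = deg b -> a = b;
  degree_map_surj : forall c : R, exists2 a : chow, chow_graded d a & deg a = c;
  degree_map_flag : forall s : d.-tuple {set E},
    path (covers M) K (rcons s L) -> deg (\prod_(F <- s) chow_var F) = 1
}.

(* The sum of the [x_F t_F] is a polynomial in [t] with coefficients in the Chow
   ring, and [map_mpoly deg] applies [deg] to each coefficient of its [d]-th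
   power; these coefficients all lie in the graded piece of degree [d]. *)
Definition vol (deg : chow -> R) : P :=
  (d`!)%:R^-1 *:
    map_mpoly deg
      ((\sum_(F : {set E} | between M K L F) chow_var F *: tvar chow M K L F)
         ^+ d).

End Chow.

(* Main.v *)
From HB Require Import structures.
Require Import Defs.
From mathcomp Require Import all_boot all_order all_algebra.
From mathcomp Require Import generic_quotient ring_quotient.
From mathcomp Require Import boolp reals.
From mathcomp Require Import mpoly zify ring.

(* Fix real values t_F and let l be the sum of the t_F x_F over K < F < L.  Then
   deg (l ^ d) is the sum of the t_F deg (x_F l ^ (d - 1)).  Modulo the
   incomparability relations, x_F kills every x_G with G incomparable to F, and
   averaging the linear relations over i in F \ K and j in L \ F rewrites
   x_F * x_F so that x_F l = x_F (l_1 + l_2), where l_1 and l_2 are the linear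
   forms of [K, F] and [F, L] at pi_K^F(t) and pi_F^L(t).  By the binomial
   formula deg (l ^ d) is a combination of the deg (x_F l_1 ^ a l_2 ^ b).

   The degree map is not needed on the smaller intervals: for every u,
   p |-> deg (x_F u p) is a linear functional killing the Chow ideals of [K, F]
   and [F, L].  So the induction is on intervals and concerns all linear
   functionals killing the Chow ideal: they vanish on l ^ a for a > d, and if
   they take the value c on every maximal flag then they take the value
   d! c pol(t) on l ^ d.  Taking first u = x_{F_1} ... x_{F_k} for a flag of
   [K, F], then u = l_2 ^ b, gives the product of the two smaller polynomials
   without computing the top degree part of the Chow ring. *)

Set Implicit Arguments.
Unset Strict Implicit.
Unset Printing Implicit Defensive.

Import Order.TTheory GRing.Theory Num.Theory.
Local Open Scope ring_scope.

(** * Ranks and chains of flats *)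

Section MatroidRank.
Variables (E : finType) (M : matroid E).
Implicit Types (A B F G K L I : {set E}).
Local Open Scope nat_scope.
Local Notation r := (mrank M).

Lemma mrank_ge A I : I \in indep M -> I \subset A -> #|I| <= r A.
Proof.
by move=> iI sI; rewrite /mrank; apply: (bigop.bigmax_sup I); rewrite ?iI.
Qed.

Lemma mrank_basis A : exists I, [/\ I \in indep M, I \subset A & #|I| = r A].
Proof.
have h0 : 0 < #|[pred B | (B \in indep M) && (B \subset A)]|.
  by apply/card_gt0P; exists set0; rewrite inE indep_set0 sub0set.
have [I /andP[iI sI] eI] := eq_bigmax_cond (fun B : {set E} => #|B|) h0.
by exists I; split=> //; rewrite -eI.
Qed.

Lemma mrankS A B : A \subset B -> r A <= r B.
Proof.
move=> sAB; have [I [iI sI <-]] := mrank_basis A.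
exact: mrank_ge iI (subset_trans sI sAB).
Qed.

Lemma mrankU1 A x : r (x |: A) <= (r A).+1.
Proof.
have [I [iI sI <-]] := mrank_basis (x |: A).
have sIx : I :\ x \subset A by rewrite subDset.
have iIx : I :\ x \in indep M by apply: indep_sub iI; apply: subD1set.
apply: leq_trans (_ : (#|I :\ x|).+1 <= _); last by rewrite ltnS mrank_ge.
by rewrite (cardsD1 x I) -add1n leq_add2r leq_b1.
Qed.

Lemma indep_extend I A : I \in indep M -> I \subset A ->
  exists J, [/\ J \in indep M, I \subset J, J \subset A & #|J| = r A].
Proof.
move=> iI sIA.
have [J /maxsetP[/andP[iJ sJA] maxJ] sIJ] :=
  maxset_exists (P := fun J => (J \in indep M) && (J \subset A))
    (introT andP (conj iI sIA)).
exists J; split=> //; apply/eqP; rewrite eqn_leq mrank_ge //= leqNgt.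
apply/negP => ltJ; have [B [iB sBA eB]] := mrank_basis A.
rewrite -eB in ltJ; have [x /setDP[xB xJ] ixJ] := indep_aug iJ iB ltJ.
move: xJ; rewrite -(maxJ (x |: J)) ?setU11 ?subsetUr // ixJ subUset sJA.
by rewrite sub1set (subsetP sBA).
Qed.

(** Extend a basis [I] of [A] to a basis [J] of [L]. The element by which a basis of [x |: L]
    augments [J] lies outside [L], so it is [x]; then [x |: I], a subset of [x |: J], is
    independent. *)
Lemma mrank_submod A L x : A \subset L ->
  r L < r (x |: L) -> r A < r (x |: A).
Proof.
move=> sAL ltL; have [I [iI sIA eI]] := mrank_basis A.
have [J [iJ sIJ sJL eJ]] := indep_extend iI (subset_trans sIA sAL).
have [B [iB sB eB]] := mrank_basis (x |: L).
have [|z /setDP[zB zJ] izJ] := indep_aug iJ iB; first by rewrite eJ eB.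
have zL : z \notin L.
  apply/negP => zL; have := mrank_ge izJ (A := L).
  by rewrite subUset sub1set zL sJL cardsU1 zJ eJ ltnn => /(_ isT).
have /setU1P[zx|] := subsetP sB z zB; last by rewrite (negPf zL).
rewrite -{}zx -eI; have zI : z \notin I by apply: contra zJ => /(subsetP sIJ).
rewrite (_ : #|I|.+1 = #|z |: I|); last by rewrite cardsU1 zI.
apply: mrank_ge; last exact: setUS.
by apply: indep_sub izJ; apply: setUS.
Qed.

Lemma flat_mrank_lt F G : flat M F -> F \proper G -> r F < r G.
Proof.
move=> /forallP fF /properP[sFG [x xG xF]].
apply: leq_trans (implyP (fF x) xF) _.
by rewrite mrankS // subUset sub1set xG.
Qed.

(** [F] is maximal among the sets of rank at most [r K + 1] between [x |: K] and [L]. Maximality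
    gives the flat condition at points of [L], [mrank_submod] at points outside. *)
Lemma flat_step K L : flat M K -> flat M L -> K \proper L ->
  exists F, [/\ flat M F, K \proper F, F \subset L & r F = (r K).+1].
Proof.
move=> fK fL /properP[sKL [x xL xK]].
pose P F := [&& x |: K \subset F, F \subset L & r F <= (r K).+1].
have Px : P (x |: K) by rewrite /P subxx subUset sub1set xL sKL mrankU1.
have [F /maxsetP[/and3P[sxF sFL rF] maxF] _] := maxset_exists Px.
have KF : K \proper F.
  apply/properP; split; first exact: subset_trans (subsetUr _ _) sxF.
  by exists x => //; apply: (subsetP sxF); rewrite setU11.
have rKF := flat_mrank_lt fK KF.
have eF : r F = (r K).+1 by apply/eqP; rewrite eqn_leq rF.
exists F; split=> //; apply/forallP => y; apply/implyP => yF.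
have [yL|yL] := boolP (y \in L); last first.
  by apply: mrank_submod sFL _; apply: (implyP (forallP fL y)).
rewrite ltnNge; apply/negP => le; move: yF.
rewrite -(maxF (y |: F)) ?setU11 ?subsetUr // /P (leq_trans le rF).
by rewrite (subset_trans sxF (subsetUr _ _)) subUset sub1set yL sFL.
Qed.

(** The rank is injective on a chain of flats, with values from [r K] to [r L]. *)
Lemma flat_chain_card K L C : flat_chain M K L C -> #|C| <= (r L - r K).+1.
Proof.
case/andP=> /forall_inP CP /forall_inP Ctot.
have inj : {in C &, injective r}.
  have aux F G : F \in C -> F \subset G -> r F = r G -> F = G.
    move=> FC sFG eFG; have /and3P[fF _ _] := CP F FC.
    by apply/eqP; rewrite eqEproper sFG; apply/negP => /(flat_mrank_lt fF);
      rewrite eFG ltnn.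
  move=> F G FC GC e; have /forall_inP/(_ G GC)/orP[s|s] := Ctot F FC.
    exact: aux s e.
  by apply: esym; apply: aux s (esym e).
rewrite cardE -(size_map r) -(size_iota (r K) (r L - r K).+1).
apply: uniq_leq_size.
  rewrite map_inj_in_uniq ?enum_uniq // => F G.
  by rewrite !mem_enum; apply: inj.
move=> n /mapP[F]; rewrite mem_enum => /CP/and3P[_ sKF sFL] ->.
rewrite mem_iota mrankS //= addnS ltnS subnKC ?mrankS //.
exact: subset_trans sFL.
Qed.

Lemma flat_chain_exists K L : flat M K -> flat M L -> K \subset L ->
  exists2 C, flat_chain M K L C & #|C| = (r L - r K).+1.
Proof.
move En: (r L - r K) => n fK fL.
elim: n K En fK => [|n IH] K En fK sKL.
  exists [set K]; last exact: cards1.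
  apply/andP; split; apply/forall_inP => F /set1P->; first by rewrite fK subxx.
  by apply/forall_inP => G /set1P->; rewrite subxx.
have KL : K \proper L.
  by rewrite properEneq sKL andbT; apply/eqP => e; rewrite e subnn in En.
have [F [fF KF sFL rF]] := flat_step fK fL KL.
have [|C /andP[/forall_inP CP /forall_inP Ctot] cC] := IH F _ fF sFL.
  by rewrite rF subnS En.
have KC G : G \in C -> K \proper G.
  by move=> /CP/and3P[_ sFG _]; apply: proper_sub_trans KF sFG.
have KnC : K \notin C by apply/negP => /KC; rewrite properxx.
exists (K |: C); last by rewrite cardsU1 KnC cC.
apply/andP; split; apply/forall_inP => G /setU1P[->|GC].
- by rewrite fK subxx.
- by have /and3P[-> _ ->] := CP G GC; rewrite proper_sub ?KC.
- by apply/forall_inP => H /setU1P[->|/KC/proper_sub->//]; rewrite subxx.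
- apply/forall_inP => H /setU1P[->|].
    by rewrite (proper_sub (KC G GC)) orbT.
  by have /forall_inP := Ctot G GC; apply.
Qed.

Lemma flat_dE K L : flat M K -> flat M L -> K \subset L ->
  flat_d M K L = (r L - r K).-1.
Proof.
move=> fK fL sKL; congr _.-1; apply/eqP; rewrite eqn_leq; apply/andP; split.
  by apply/bigop.bigmax_leqP => C /flat_chain_card; rewrite -ltnS; case: #|C|.
have [C hC cC] := flat_chain_exists fK fL sKL.
by rewrite /flat_rk; apply: (bigop.bigmax_sup C); rewrite ?cC.
Qed.

Lemma flat_d_between K L F : flat M K -> flat M L -> between M K L F ->
  flat_d M K L = (flat_d M K F + flat_d M F L).+1.
Proof.
move=> fK fL /and3P[fF KF FL].
rewrite !flat_dE ?proper_sub ?(proper_trans KF FL) //.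
have := flat_mrank_lt fK KF; have := flat_mrank_lt fF FL; lia.
Qed.

End MatroidRank.

(** * Functionals killing the Chow ideal of an interval *)

Section IntervalFunctionals.
Variables (R : realType) (E : finType) (M : matroid E).
Variables (A : comAlgType R) (x : {set E} -> A).
Implicit Types (F G K L : {set E}) (t w : {set E} -> R) (phi : {scalar A}).

Definition lform t K L : A := \sum_(F | between M K L F) t F *: x F.

(** Letting [p] vary makes this vanishing on the whole ideal that the relations generate in [A]. The
    form in the second clause is the linear relation of [i] and [j]. *)
Definition kills_chow_ideal phi K L : Prop :=
  (forall F G p, between M K L F -> between M K L G ->
     ~~ (F \subset G) -> ~~ (G \subset F) -> phi (p * (x F * x G)) = 0) /\
  (forall i j p, i \in L :\: K -> j \in L :\: K ->
     phi (p * lform (fun F => (i \in F)%:R - (j \in F)%:R) K L) = 0).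

Lemma lformD t w K L :
  lform (fun F => t F + w F) K L = lform t K L + lform w K L.
Proof.
by rewrite -big_split; apply: eq_bigr => F _; rewrite scalerDl.
Qed.

Lemma lformZ c w K L : lform (fun F => c * w F) K L = c *: lform w K L.
Proof. by rewrite scaler_sumr; apply: eq_bigr => F _; rewrite scalerA. Qed.

Lemma lform_sum (I : finType) (P : pred I) (w : I -> {set E} -> R) K L :
  lform (fun F => \sum_(i | P i) w i F) K L = \sum_(i | P i) lform (w i) K L.
Proof.
by rewrite exchange_big; apply: eq_bigr => F _; rewrite scaler_suml.
Qed.

Lemma eq_lform t w K L : (forall F, between M K L F -> t F = w F) ->
  lform t K L = lform w K L.
Proof. by move=> e; apply: eq_bigr => F /e ->. Qed.

Lemma lform_eq0 t K L : (forall F, between M K L F -> t F = 0) ->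
  lform t K L = 0.
Proof. by move=> e; apply: big1 => F /e ->; rewrite scale0r. Qed.

Lemma betweenW K L F : between M K L F ->
  (forall G, between M K F G -> between M K L G) /\
  (forall G, between M F L G -> between M K L G).
Proof.
case/and3P=> fF KF FL; split=> G /and3P[fG H1 H2]; apply/and3P; split=> //.
  exact: proper_trans FL.
exact: proper_trans H1.
Qed.

Lemma lform_split phi K L F q w :
  kills_chow_ideal phi K L -> between M K L F ->
  phi (q * (x F * lform w K L)) =
  phi (q * (x F * (lform w K F + w F *: x F + lform w F L))).
Proof.
move=> [hI _] bF; have [bKF bFL] := betweenW bF.
have [fF KF FL] := and3P bF.
pose inc G := ~~ (G \subset F) && ~~ (F \subset G).
have -> : lform w K L = lform w K F + w F *: x F + lform w F L +
    \sum_(G | between M K L G && inc G) w G *: x G.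
  rewrite /lform (bigID inc) /= addrC; congr (_ + _).
  rewrite (bigID (fun G => G \proper F)) /= -addrA; congr (_ + _).
    apply: eq_bigl => G; apply/idP/idP.
      by case/andP=> /andP[/and3P[fG KG _] _] GF; apply/and3P.
    move=> bG; have /and3P[_ _ GF] := bG.
    by rewrite bKF // GF /inc (proper_sub GF).
  rewrite (bigD1 F) /=; last by rewrite bF properxx /inc subxx.
  congr (_ + _); apply: eq_bigl => G; apply/idP/idP; last first.
    move=> bG; have /and3P[_ FG _] := bG.
    rewrite bFL // /inc (proper_sub FG) andbF /=; apply/andP; split.
      by apply/negP => /(proper_trans FG); rewrite properxx.
    by apply: contraTneq FG => ->; rewrite properxx.
  case/andP=> /andP[/andP[/and3P[fG KG GL]]]; rewrite /inc negb_and !negbK.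
  rewrite [G \proper F]properEneq => h1 h2 nGF; apply/and3P; split=> //.
  by move: h1 h2; rewrite properEneq nGF eq_sym nGF /= => /orP[->|].
rewrite 2!mulrDr linearD /= [X in _ + X](_ : _ = 0) ?addr0 //.
rewrite !mulr_sumr linear_sum big1 // => G /andP[bG /andP[nGF nFG]] /=.
by rewrite -!scalerAr linearZ /= hI ?mulr0.
Qed.

Definition mulscalar (u : A) phi : {scalar A} := phi \o (u \*o idfun).

Lemma mulscalarE u phi p : mulscalar u phi p = phi (u * p).
Proof. by []. Qed.

(** The relation of two points of [F \ K] has coefficient 0 at [F] and at the flats above, which
    contain both points; multiplied by [x F], only the relation of [K, F] is left. For two points of
    [L \ F], the flats up to [F] contain neither. *)
Lemma kills_restrict phi K L F u : kills_chow_ideal phi K L ->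
  between M K L F ->
  kills_chow_ideal (mulscalar (x F * u) phi) K F /\
  kills_chow_ideal (mulscalar (x F * u) phi) F L.
Proof.
move=> hk bF; have [hI hJ] := hk; have [bKF bFL] := betweenW bF.
have [_ /proper_sub KF /proper_sub FL] := and3P bF.
have mulA p q : x F * u * (p * q) = u * p * (x F * q) by ring.
pose w i j G : R := (i \in G)%:R - (j \in G)%:R.
have red i j p : i \in L -> i \notin K -> j \in L -> j \notin K ->
    phi (u * p * (x F * (lform (w i j) K F + w i j F *: x F
                         + lform (w i j) F L))) = 0.
  move=> iL iK jL jK; rewrite -(lform_split _ _ hk bF) mulrCA mulrA.
  by rewrite hJ // inE ?iK ?jK.
split; split=> [G H p bG bH nGH nHG|i j p].
- by rewrite mulscalarE mulrA hI ?bKF.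
- move=> /setDP[iF iK] /setDP[jF jK]; rewrite mulscalarE mulA.
  have := red i j p (subsetP FL i iF) iK (subsetP FL j jF) jK.
  rewrite {2}/w iF jF subrr scale0r addr0 [lform _ F L]lform_eq0 ?addr0 //.
  by move=> G /and3P[_ /proper_sub/subsetP FG _]; rewrite /w !FG ?subrr.
- by rewrite mulscalarE mulrA hI ?bFL.
- move=> /setDP[iL iF] /setDP[jL jF]; rewrite mulscalarE mulA.
  have nK k : k \notin F -> k \notin K by apply: contra => /(subsetP KF).
  have := red i j p iL (nK i iF) jL (nK j jF).
  rewrite {2}/w (negPf iF) (negPf jF) subrr scale0r addr0.
  rewrite [lform _ K F]lform_eq0 ?add0r //.
  move=> G /and3P[_ _ /proper_sub/subsetP GF].
  by rewrite /w !(contraNF (GF _)) ?subrr.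
Qed.

Lemma sum_mem_indicator F (B : {set E}) :
  \sum_(i in B) (i \in F)%:R = #|F :&: B|%:R :> R.
Proof.
rewrite -natr_sum setIC -sum1_card.
rewrite [in RHS](eq_bigl (fun i => (i \in B) && (i \in F))); last first.
  by move=> i; rewrite inE.
by rewrite big_mkcondr; congr _%:R; apply: eq_bigr => i _; case: (i \in F).
Qed.

Lemma lform_reduce phi K L F q t :
  kills_chow_ideal phi K L -> between M K L F -> t K = 0 -> t L = 0 ->
  phi (q * (x F * lform t K L)) =
  phi (q * (x F * (lform (piFG K F (t : _ -> R^o)) K F
                   + lform (piFG F L (t : _ -> R^o)) F L))).
Proof.
move=> hk bF tK tL; have [_ KF FL] := and3P bF.
have [sKF sFL] := (proper_sub KF, proper_sub FL).
pose a : R := #|F :\: K|%:R; pose b : R := #|L :\: F|%:R.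
have a0 : a != 0 by rewrite pnatr_eq0 -lt0n proper_setD_gt0.
have b0 : b != 0 by rewrite pnatr_eq0 -lt0n proper_setD_gt0.
(* [W] is the sum over [i in F \ K] and [j in L \ F] of the coefficients of the
   linear relation of [i] and [j]. *)
pose W G : R := b * #|G :&: (F :\: K)|%:R - a * #|G :&: (L :\: F)|%:R.
have WE G : W G = \sum_(i in F :\: K) \sum_(j in L :\: F)
    ((i \in G)%:R - (j \in G)%:R).
  under eq_bigr do rewrite sumrB sumr_const.
  by rewrite sumrB sumr_const sumrMnl !sum_mem_indicator /W !mulr_natl.
have phiW : phi (q * (x F * lform W K L)) = 0.
  rewrite (eq_lform (fun G _ => WE G)) lform_sum !mulr_sumr linear_sum big1 //.
  move=> i /setDP[iF iK]; rewrite lform_sum !mulr_sumr linear_sum big1 //.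
  move=> j /setDP[jL jF]; rewrite mulrA; apply: hk.2; rewrite inE ?iK ?jL.
    by rewrite (subsetP sFL).
  by rewrite andbT; apply: contra jF; apply: (subsetP sKF).
(* Since [W F = a * b], this multiple of the relation cancels the coefficient of [x F], which
   removes the square of [x F]. *)
pose w G := t G + (- (t F / (a * b))) * W G.
have -> : phi (q * (x F * lform t K L)) = phi (q * (x F * lform w K L)).
  rewrite lformD lformZ 2!mulrDr linearD /= -!scalerAr linearZ /= phiW.
  by rewrite mulr0 addr0.
rewrite (lform_split _ _ hk bF).
have WF : W F = a * b.
  rewrite /W (setIidPr (subsetDl _ _)) (_ : F :&: _ = set0) ?cards0.
    by rewrite mulr0 subr0 mulrC.
  by apply/setP => i; rewrite !inE; case: (i \in F).
have -> : w F = 0 by rewrite /w WF mulNr divfK ?subrr // mulf_neq0.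
(* The correction is [t F] times |G \ K| / |F \ K| below [F], and [t F] times |L \ G| / |L \ F|
   above: the terms of [piFG] left when [t K = t L = 0]. *)
rewrite scale0r addr0; congr (phi (q * (x F * (_ + _)))); apply: eq_lform.
  move=> G /and3P[_ /proper_sub KG /proper_sub GF].
  rewrite /w /piFG tK scaler0 subr0; congr (_ + _).
  have -> : W G = b * #|G :\: K|%:R.
    rewrite /W (_ : G :&: _ = G :\: K); last first.
      apply/setP => i; rewrite !inE; have := subsetP GF i.
      by case: (i \in G) => [->|]; rewrite ?andbT ?andbF.
    rewrite (_ : G :&: _ = set0) ?cards0 ?mulr0 ?subr0 //.
    apply/setP => i; rewrite !inE; have := subsetP GF i.
    by case: (i \in G) => [->|].
  rewrite -[_ *: _]/(_ * _) -/a; field; exact/andP.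
move=> G /and3P[_ /proper_sub FG /proper_sub GL].
rewrite /w /piFG tL scaler0 subr0; congr (_ + _).
have -> : W G = a * #|L :\: G|%:R.
  rewrite /W (_ : G :&: (F :\: K) = F :\: K); last first.
    by apply/setIidPr; apply: subset_trans (subsetDl _ _) FG.
  rewrite (_ : G :&: _ = G :\: F); last first.
    by rewrite setIDA (setIidPl GL).
  rewrite -/a (mulrC b) -mulrBr /b !cardsDS //.
  rewrite -natrB ?leq_sub2r ?subset_leq_card //.
  rewrite subnBA ?subset_leq_card // subnK //.
  by rewrite subset_leq_card // (subset_trans FG).
rewrite -[_ *: _]/(_ * _) -/b; field; exact/andP.
Qed.

End IntervalFunctionals.

(** * Values of the recursive polynomial at real points *)

Section EvaluatedPol.
Variables (R : realType) (E : finType) (M : matroid E).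
Implicit Types (F G K L : {set E}) (t : {set E} -> R).

Definition pol_at K L t : R := (pol R M K L).@[fun i => t (btw_set i)].

(** The values of the [tvar], which are 0 outside the open interval, in particular at [K] and [L].
    [R^o] is [R] as a module over itself, as [piFG] expects. *)
Definition trunc K L t (F : {set E}) : R^o :=
  if between M K L F then t F else 0.

Lemma meval_tvar K L t F :
  (tvar R M K L F).@[fun i => t (btw_set i)] = trunc K L t F.
Proof.
rewrite /tvar /trunc; case: insubP => [u bF eu|/negPf->]; last exact: meval0.
by rewrite bF mevalXU /btw_set enum_rankK eu.
Qed.

Lemma meval_psubst K L F G t p :
  (psubst (piFG F G (tvar R M K L)) p).@[fun i => t (btw_set i)] =
  p.@[fun i : 'I_(nbtw M F G) => piFG F G (trunc K L t) (btw_set i)].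
Proof.
rewrite /psubst comp_mpoly_meval; apply: meval_eq => i.
by rewrite tnth_mktuple /piFG !mevalB !mevalZ !meval_tvar.
Qed.

Lemma pol_atE K L t : K \proper L ->
  pol_at K L t = if flat_d M K L == 0%N then 1 else
    (flat_d M K L)%:R^-1 * \sum_(F | between M K L F)
      t F * pol_at K F (piFG K F (trunc K L t))
          * pol_at F L (piFG F L (trunc K L t)).
Proof.
move=> KL; rewrite /pol_at polE //; case: ifP => _; first exact: meval1.
rewrite mevalZ raddf_sum; congr (_ * _); apply: eq_bigr => F bF /=.
by rewrite !mevalM !meval_psubst meval_tvar /trunc bF.
Qed.

End EvaluatedPol.

(** * Powers of linear forms under a functional *)

Section PowersOfLinearForms.
Variables (R : realType) (E : finType) (M : matroid E).
Variables (A : comAlgType R) (x : {set E} -> A).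
Implicit Types (F G K L : {set E}) (t w : {set E} -> R) (phi : {scalar A}).

Lemma scalar_lform_exp phi K L t n : kills_chow_ideal M x phi K L ->
  K \proper L ->
  phi (lform M x t K L ^+ n.+1) =
  \sum_(F | between M K L F) t F * \sum_(i < n.+1)
    phi (x F * lform M x (piFG K F (trunc M K L t)) K F ^+ (n - i)
             * lform M x (piFG F L (trunc M K L t)) F L ^+ i) *+ 'C(n, i).
Proof.
move=> hk KL; have -> : lform M x t K L = lform M x (trunc M K L t) K L.
  by apply: eq_lform => F bF; rewrite /trunc bF.
rewrite exprS {1}/lform mulr_suml linear_sum; apply: eq_bigr => F bF /=.
rewrite -scalerAl linearZ /= {1}/trunc bF; congr (_ * _).
set l1 := lform _ _ _ K F; set l2 := lform _ _ _ F L.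
set l := lform M x _ K L.
have tK : trunc M K L t K = 0 by rewrite /trunc /between properxx andbF.
have tL : trunc M K L t L = 0 by rewrite /trunc /between properxx !andbF.
(* [q] is arbitrary so that it can absorb one factor [l] while the others are replaced, then the
   replaced ones while that last [l] is. *)
have step m q : phi (q * (x F * l ^+ m)) = phi (q * (x F * (l1 + l2) ^+ m)).
  elim: m q => [//|m IH] q; rewrite !exprS.
  rewrite (_ : q * _ = q * l * (x F * l ^+ m)); last by ring.
  rewrite IH (_ : _ * _ = q * (l1 + l2) ^+ m * (x F * l)); last first.
    by move: (_ ^+ m) => s; ring.
  rewrite (lform_reduce _ hk bF tK tL); congr (phi _).
  by rewrite -/l1 -/l2; move: (_ ^+ m) => s; ring.
have := step n 1; rewrite !mul1r => ->.
rewrite exprDn mulr_sumr linear_sum; apply: eq_bigr => i _ /=.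
by rewrite mulrnAr raddfMn mulrA.
Qed.

(** Every term of the expansion has total exponent above d(K, F) + d(F, L) in [l1] and [l2], so one
    of the two powers vanishes by induction, the other being absorbed in the functional. *)
Lemma scalar_lform_exp_eq0 n phi K L t a :
  (#|L :\: K| <= n)%N -> flat M K -> flat M L -> K \proper L ->
  kills_chow_ideal M x phi K L -> (flat_d M K L < a)%N ->
  phi (lform M x t K L ^+ a) = 0.
Proof.
elim: n phi K L t a => [|n IH] phi K L t [//|a] leKLn fK fL KL hk lt_d_a.
  by have := leq_trans (proper_setD_gt0 KL) leKLn.
rewrite (scalar_lform_exp _ _ hk KL) big1 // => F bF.
have [fF KF FL] := and3P bF; have [cF1 cF2] := between_card bF.
have dE := flat_d_between fK fL bF.
rewrite big1 ?mulr0 // => i _; have := ltn_ord i; rewrite ltnS => lei.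
have [lt1|le1] := ltnP (flat_d M K F) (a - i).
  rewrite mulrAC -mulscalarE IH ?mul0rn //.
    by rewrite -ltnS (leq_trans cF1).
  exact: (kills_restrict _ hk bF).1.
rewrite -mulscalarE IH ?mul0rn //; last by lia.
  by rewrite -ltnS (leq_trans cF2).
exact: (kills_restrict _ hk bF).2.
Qed.

(** Put d1 = d(K, F) and d2 = d(F, L). By the vanishing above, only [l1 ^ d1 * l2 ^ d2] survives for
    each [F]; its binomial coefficient times d1! d2! is (d1 + d2)!, and d(K, L) = d1 + d2 + 1 gives
    the recursion of [pol]. *)
Lemma scalar_lform_exp_flat_d n phi K L t c :
  (#|L :\: K| <= n)%N -> flat M K -> flat M L -> K \proper L ->
  kills_chow_ideal M x phi K L ->
  (forall s, size s = flat_d M K L -> path (covers M) K (rcons s L) ->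
     phi (\prod_(F <- s) x F) = c) ->
  phi (lform M x t K L ^+ flat_d M K L) =
  (flat_d M K L)`!%:R * (c * pol_at M K L t).
Proof.
elim: n phi K L t c => [|n IH] phi K L t c leKLn fK fL KL hk hc.
  by have := leq_trans (proper_setD_gt0 KL) leKLn.
rewrite pol_atE //; case Ed: (flat_d M K L) => [|d].
  (* The empty flag is maximal, as a flat strictly between would make d(K, L) positive; so [c] is
     [phi 1]. *)
  rewrite expr0 fact0 mul1r mulr1 -(hc [::]) ?Ed ?big_nil //=.
  rewrite andbT /covers fK fL KL /=; apply/negP => /existsP[F bF].
  by rewrite (flat_d_between fK fL bF) in Ed.
rewrite (scalar_lform_exp _ _ hk KL) factS natrM.
have d0 : (d.+1)%:R != 0 :> R by rewrite pnatr_eq0.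
set S := (X in _^-1 * X).
rewrite (_ : _ * (c * _) = d`!%:R * c * S); last first.
  by field; rewrite nat1r.
rewrite /S mulr_sumr {S}; apply: eq_bigr => F bF.
have [fF KF FL] := and3P bF; have [cF1 cF2] := between_card bF.
have leFK : (#|F :\: K| <= n)%N by rewrite -ltnS (leq_trans cF1).
have leLF : (#|L :\: F| <= n)%N by rewrite -ltnS (leq_trans cF2).
have dE := flat_d_between fK fL bF; rewrite Ed in dE; case: dE => dE.
set l1 := lform _ _ _ K F; set l2 := lform _ _ _ F L.
have d2d : (flat_d M F L < d.+1)%N by rewrite ltnS dE leq_addl.
rewrite (bigD1 (Ordinal d2d)) //= big1 ?addr0 => [|i nei]; last first.
  have [lt1|le1] := ltnP (flat_d M K F) (d - i).
    rewrite mulrAC -mulscalarE (scalar_lform_exp_eq0 _ leFK) ?mul0rn //.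
    exact: (kills_restrict _ hk bF).1.
  have lt2 : (flat_d M F L < i)%N.
    by move: nei; rewrite -val_eqE /=; have := ltn_ord i; lia.
  rewrite -mulscalarE (scalar_lform_exp_eq0 _ leLF) ?mul0rn //.
  exact: (kills_restrict _ hk bF).2.
rewrite {1}dE addnK mulrAC -mulscalarE.
have [hk1 _] := kills_restrict (l2 ^+ flat_d M F L) hk bF.
(* This constant is the value of the functional multiplied by [x F] and the power of [l2] on each
   maximal flag [s1] of [K, F]; it comes from induction on [F, L] with the product over [s1] as
   multiplier. *)
rewrite (IH _ _ _ _ (c * (flat_d M F L)`!%:R * pol_at M F L
  (piFG F L (trunc M K L t))) leFK fK fF KF hk1) => [|s1 size_s1 p1].
  rewrite -(bin_fact (m := flat_d M F L) (n := d)) ?dE ?leq_addl // addnK.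
  by rewrite !natrM; ring.
rewrite mulscalarE mulrAC -mulscalarE.
have [_ hk2] := kills_restrict (\prod_(G <- s1) x G) hk bF.
rewrite (IH _ _ _ _ c leLF fF fL FL hk2) => [|s2 size_s2 p2].
  by ring.
rewrite mulscalarE -(hc (s1 ++ F :: s2)).
- by rewrite big_cat big_cons /=; congr (phi _); ring.
- by rewrite size_cat /= size_s1 size_s2 Ed dE addnS.
by move: p1 p2; rewrite rcons_cat cat_path rcons_path /= => /andP[-> ->].
Qed.
End PowersOfLinearForms.

(** * Polynomials with equal values *)

Section Digits.
Local Open Scope nat_scope.

Lemma digits_inj n b (f g : 'I_n -> nat) :
  (forall i, f i < b) -> (forall i, g i < b) ->
  \sum_i f i * b ^ i = \sum_i g i * b ^ i -> f =1 g.
Proof.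
elim: n f g => [|n IH] f g fb gb; first by move=> _ [].
rewrite !big_ord_recl !muln1.
have shift (h : 'I_n.+1 -> nat) : \sum_(i < n) h (lift ord0 i) * b ^ lift ord0 i
    = (\sum_(i < n) h (lift ord0 i) * b ^ i) * b.
  by rewrite big_distrl /=; apply: eq_bigr => i _; rewrite expnSr mulnA.
rewrite !shift => e; have b0 : 0 < b by apply: leq_ltn_trans (fb ord0).
have e0 : f ord0 = g ord0.
  have := congr1 (modn^~ b) e.
  by rewrite /= !(addnC _ (_ * b)) !modnMDl !modn_small.
move: e; rewrite e0 => /addnI/eqP; rewrite eqn_pmul2r // => /eqP/IH eS i.
case: (unliftP ord0 i) => [j ->|-> //].
exact: (eS (fun _ => fb _) (fun _ => gb _)).
Qed.

End Digits.

(** The naturals below [size p] would be too many roots for a nonzero [p]. *)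
Lemma poly_horner_eq0 (R : numDomainType) (p : {poly R}) :
  (forall y, p.[y] = 0) -> p = 0.
Proof.
move=> p0; apply/eqP; apply: contraT => nz.
have := max_poly_roots (rs := [seq i%:R | i <- iota 0 (size p)]) nz.
rewrite size_map size_iota ltnn => -> //.
  by apply/allP => y _; apply/eqP.
by rewrite map_inj_uniq ?iota_uniq // => i j /eqP; rewrite eqr_nat => /eqP.
Qed.

(* Kronecker substitution: substituting [y ^+ (b ^ i)] for the [i]-th variable,
   with [b] larger than all exponents, keeps distinct monomials distinct. *)
Lemma mpoly_meval_inj (R : numDomainType) n (p q : {mpoly R[n]}) :
  (forall v, p.@[v] = q.@[v]) -> p = q.
Proof.
move=> epq; apply/eqP; rewrite -subr_eq0; apply/eqP.
have {epq} : forall v, (p - q).@[v] = 0 by move=> v; rewrite mevalB epq subrr.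
move: (p - q) => {p q} p p0; apply/mpolyP => m; rewrite mcoeff0.
have [|/memN_msupp_eq0 //] := boolP (m \in msupp p) => mp.
(* [msize p] exceeds the degree of every monomial of [p], so the exponents are digits in base
   [b]. *)
pose b := msize p; pose code (m : 'X_{1..n}) := (\sum_i m i * b ^ i)%N.
have digit m' i : m' \in msupp p -> (m' i < b)%N.
  move=> /msize_mdeg_lt; apply: leq_trans; rewrite ltnS mdegE.
  by rewrite (bigD1 i) //= leq_addr.
pose u : {poly R} := \sum_(m' <- msupp p) p@_m' *: 'X^(code m').
have u0 : u = 0.
  apply: poly_horner_eq0 => y; have := p0 (fun i => y ^+ (b ^ i)).
  rewrite mevalE => e; rewrite -{}[RHS]e horner_sum; apply: eq_bigr => m' _.
  rewrite hornerZ hornerXn; congr (_ * _); rewrite /code expr_sum.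
  by apply: eq_bigr => i _; rewrite mulnC exprM.
have := congr1 (fun r : {poly R} => r`_(code m)) u0.
rewrite coef0 coef_sum (bigD1_seq m) //= coefZ coefXn eqxx mulr1 big_seq_cond.
rewrite big1 ?addr0 // => m' /andP[mp' nem]; rewrite coefZ coefXn.
case: eqP => [e|]; last by rewrite mulr0.
case/eqP: nem; apply/mnmP => i; apply: esym.
by apply: (digits_inj _ _ e) => j; apply: digit.
Qed.

(** * The volume polynomial as a functional *)

Section ChowRing.
Variables (R : realType) (E : finType) (M : matroid E) (K L : {set E}).
Local Notation P := {mpoly R[nbtw M K L]}.
Local Notation x := (tvar R M K L).
Local Notation d := (flat_d M K L).
Local Notation proj := (@chow_proj R E M K L).
Local Notation chow := (chow R M K L).

Lemma chow_projZ c (p : P) : proj (c *: p) = c *: proj p.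
Proof. by rewrite -mul_mpolyC chow_projM. Qed.

Fact chow_proj_is_linear : linear proj.
Proof. by move=> c p q; rewrite chow_projD chow_projZ. Qed.
HB.instance Definition _ :=
  GRing.isLinear.Build R P chow _ proj chow_proj_is_linear.

Fact chow_proj_is_monoid_morphism : monoid_morphism proj.
Proof. by split; [exact: chow_proj1 | exact: chow_projM]. Qed.
HB.instance Definition _ :=
  GRing.isMonoidMorphism.Build P chow proj chow_proj_is_monoid_morphism.

Lemma chow_proj_eq0 (p : P) :
  p \in @chow_ideal R E M K L -> proj p = 0.
Proof.
move=> Ip; have : (p - 0) \in @chow_ideal R E M K L by rewrite subr0.
by rewrite Quotient.idealrBE => /eqP e; rewrite [LHS]e; apply: (linear0 proj).
Qed.

Lemma tvar_homog F : x F \is 1.-homog.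
Proof.
rewrite /tvar; case: insubP => [u _ _|_]; last exact: dhomog0.
by rewrite dhomogX /= mdeg1.
Qed.

Lemma lform_homog t : lform M x t K L \is 1.-homog.
Proof. by apply: rpred_sum => F _; apply: dhomogZ; apply: tvar_homog. Qed.

Lemma chow_proj_I F G : between M K L F -> between M K L G ->
  ~~ (F \subset G) -> ~~ (G \subset F) -> proj (x F * x G) = 0.
Proof.
move=> bF bG nFG nGF; apply: chow_proj_eq0; apply/asboolP.
exists (x F * x G), 0; rewrite addr0; split=> //; last exact: ideal_gen0.
exists [:: (1, x F * x G)]; rewrite big_seq1 mul1r; split=> // u.
by rewrite inE => /eqP->; exists F, G.
Qed.

Lemma chow_proj_J i j : i \in L :\: K -> j \in L :\: K ->
  proj (lform M x (fun F => (i \in F)%:R - (j \in F)%:R) K L) = 0.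
Proof.
have [->|neij] := eqVneq i j => iLK jLK.
  by rewrite lform_eq0 ?linear0 // => F _; rewrite subrr.
have ind k : \sum_(F | between M K L F && (k \in F)) x F =
    \sum_(F | between M K L F) (k \in F)%:R *: x F.
  rewrite big_mkcondr; apply: eq_bigr => F _.
  by case: (k \in F); rewrite ?scale1r ?scale0r.
apply: chow_proj_eq0; apply/asboolP; set q := lform _ _ _ _ _.
exists 0, q; rewrite add0r; split=> //; first exact: ideal_gen0.
exists [:: (1, q)]; rewrite big_seq1 mul1r; split=> // u.
rewrite inE => /eqP->; exists i, j; split=> //.
rewrite !ind -sumrB; apply: eq_bigr => F _; by rewrite scalerBl.
Qed.

Lemma chow_gradedZD k c (a b : chow) :
  chow_graded k a -> chow_graded k b -> chow_graded k (c *: a + b).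
Proof.
case=> [p hp ->] [q hq ->]; exists (c *: p + q).
  by rewrite dhomogD // dhomogZ.
by rewrite chow_projD chow_projZ.
Qed.

Lemma chow_graded0 k : chow_graded k (0 : chow).
Proof. by exists 0; rewrite ?dhomog0 ?linear0. Qed.

Lemma chow_gradedM k l (a b : chow) :
  chow_graded k a -> chow_graded l b -> chow_graded (k + l) (a * b).
Proof.
case=> [p hp ->] [q hq ->]; exists (p * q); first exact: dhomogM.
by rewrite chow_projM.
Qed.

Lemma chow_graded_sum k (I : Type) (r : seq I) (Q : pred I) (F : I -> chow) :
  (forall i, Q i -> chow_graded k (F i)) ->
  chow_graded k (\sum_(i <- r | Q i) F i).
Proof.
move=> h; elim/big_rec: _ => [|i y Qi hy]; first exact: chow_graded0.
by rewrite -[F i]scale1r; apply: chow_gradedZD => //; apply: h.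
Qed.

Lemma chow_graded_var F : chow_graded 1 (chow_var R M K L F).
Proof. by exists (x F); rewrite ?tvar_homog. Qed.

Definition generic_form : {mpoly chow[nbtw M K L]} :=
  \sum_(F : {set E} | between M K L F)
    chow_var R M K L F *: tvar chow M K L F.

(** This lets [deg], linear only in degree [d], be applied term by term. *)
Lemma generic_form_graded k m : chow_graded k ((generic_form ^+ k)@_m).
Proof.
elim: k m => [|k IH] m.
  rewrite expr0 mcoeff1; case: eqP => _; last exact: chow_graded0.
  by exists 1; rewrite ?chow_proj1 ?dhomog1.
rewrite exprSr mcoeffM; apply: chow_graded_sum => i _; rewrite -addn1.
apply: chow_gradedM; first exact: IH.
rewrite raddf_sum; apply: chow_graded_sum => F bF /=.
rewrite mcoeffZ /tvar; case: insubP => [u _ _|_]; last first.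
  by rewrite mcoeff0 mulr0; apply: chow_graded0.
rewrite mcoeffX; case: eqP => _; last by rewrite mulr0; apply: chow_graded0.
by rewrite mulr1; apply: chow_graded_var.
Qed.

Variable deg : chow -> R.
Hypothesis deg_map : is_degree_map deg.

Lemma degree_map0 : deg 0 = 0.
Proof.
have := degree_map_linear deg_map 1 (chow_graded0 d) (chow_graded0 d).
by rewrite scaler0 addr0 mul1r => /eqP; rewrite -subr_eq subrr eq_sym => /eqP.
Qed.

Lemma degree_map_sum (I : eqType) (r : seq I) (c : I -> R) (F : I -> chow) :
  (forall i, chow_graded d (F i)) ->
  deg (\sum_(i <- r) c i *: F i) = \sum_(i <- r) c i * deg (F i).
Proof.
move=> h; elim: r => [|i r IH]; first by rewrite !big_nil degree_map0.
rewrite !big_cons (degree_map_linear deg_map) ?IH //.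
apply: chow_graded_sum => j _; rewrite -[_ *: _]addr0.
by apply: chow_gradedZD (chow_graded0 _).
Qed.

(** At real [t] the generic form becomes the image of [lform], and evaluation commutes with [deg] on
    coefficients because these all have degree [d]. *)
Lemma meval_vol (t : {set E} -> R) :
  (vol deg).@[fun i => t (btw_set i)] =
  (d`!)%:R^-1 * deg (proj (lform M x t K L ^+ d)).
Proof.
rewrite /vol mevalZ -/generic_form; congr (_ * _).
set Q := generic_form ^+ d.
have -> : proj (lform M x t K L ^+ d) = Q.@[fun i => proj (t (btw_set i))%:MP].
  rewrite !rmorphXn /=; congr (_ ^+ _).
  (* [chow] carries several convertible instances of the same structure, on
     which rewriting with a morphism of sums is prohibitively slow; relating
     the two sums term by term avoids unifying them. *)
  rewrite /generic_form [LHS](raddf_sum proj); apply: esym.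
  apply: (big_rec2 (fun a b => a.@[_] = b)) => [|F b a bF e].
    exact: meval0.
  rewrite mevalD e; congr (_ + _); rewrite mevalZ /= chow_projZ mulrC.
  congr (_ * _); rewrite /tvar; case: insubP => [u _ <-|]; last by rewrite bF.
  by rewrite mevalXU /btw_set enum_rankK.
rewrite [Q.@[_]]mevalE.
transitivity (deg (\sum_(m <- msupp Q)
    (\prod_i (t (btw_set i)) ^+ m i) *: Q@_m)).
  rewrite degree_map_sum => [|m]; last exact: generic_form_graded.
  rewrite (_ : map_mpoly deg Q = \sum_(m <- msupp Q) deg Q@_m *: 'X_[m]).
    by rewrite raddf_sum; apply: eq_bigr => m _ /=; rewrite mevalZ mevalX mulrC.
  by apply: eq_bigr => m _; rewrite mmap1_id mul_mpolyC.
congr deg; apply: (big_rec2 (fun a b => a = b)) => [|m a b _ ->] //.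
rewrite mulrC; congr (_ + _).
rewrite -[_ *: _]/(proj _ * _); congr (_ * _).
apply: (big_rec2 (fun a b => proj a%:MP = b)) => [|i a' b' _ <-].
  exact: chow_proj1.
by rewrite mpolyCM chow_projM; congr (_ * _); rewrite !rmorphXn.
Qed.

(** Taking the part of degree [d] first turns [deg] into a linear functional on all polynomials. *)
Definition top_degree (p : P) : R := deg (proj (pihomog mdeg d p)).

Fact top_degree_is_scalar : scalar top_degree.
Proof.
move=> c p q; rewrite /top_degree !linearP /=.
by apply: (degree_map_linear deg_map); [exists (pihomog mdeg d p) |
  exists (pihomog mdeg d q)]; rewrite ?pihomogP.
Qed.
HB.instance Definition _ :=
  GRing.isLinear.Build R P R _ top_degree top_degree_is_scalar.

(** Split [p] into monomials: each ['X_[m] * q] is homogeneous and vanishes in the Chow ring, so its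
    part of degree [d] is itself or 0. *)
Lemma top_degreeM_eq0 (p q : P) k : q \is k.-homog -> proj q = 0 ->
  top_degree (p * q) = 0.
Proof.
move=> hq q0; rewrite [p]mpolyE mulr_suml linear_sum big1 // => m _ /=.
rewrite -scalerAl linearZ /=; set y := top_degree _.
suff -> : y = 0 by rewrite mulr0.
have h : 'X_[m] * q \is (mdeg m + k).-homog by rewrite dhomogM // dhomogX.
rewrite /y /top_degree; have [<-|ned] := eqVneq (mdeg m + k)%N d.
  by rewrite pihomog_dE // rmorphM /= q0 mulr0 degree_map0.
by rewrite (pihomog_ne0 ned h) linear0 degree_map0.
Qed.

Lemma top_degree_kills : kills_chow_ideal M x top_degree K L.
Proof.
split=> [F G p bF bG nFG nGF|i j p iLK jLK].
  apply: top_degreeM_eq0 (dhomogM (tvar_homog F) (tvar_homog G)) _.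
  exact: chow_proj_I.
apply: top_degreeM_eq0 (lform_homog _) _; exact: chow_proj_J.
Qed.

Lemma top_degree_homog p : p \is d.-homog -> top_degree p = deg (proj p).
Proof. by move=> hp; rewrite /top_degree pihomog_dE. Qed.

Lemma top_degree_flag s : size s = d -> path (covers M) K (rcons s L) ->
  top_degree (\prod_(F <- s) x F) = 1.
Proof.
move=> /eqP size_s ps; rewrite top_degree_homog ?rmorph_prod.
  exact: (degree_map_flag deg_map (s := Tuple size_s)).
rewrite -(eqP size_s); elim: (s) => [|F s' IH].
  by rewrite big_nil dhomog1.
by rewrite big_cons /= -add1n dhomogM ?tvar_homog.
Qed.

End ChowRing.

Theorem theorem5p3 (R : realType) (E : finType) (M : matroid E)
    (K L : {set E}) (deg : chow R M K L -> R) :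
  flat M K -> flat M L -> K \proper L ->
  is_degree_map deg ->
  vol deg = pol R M K L.
Proof.
move=> fK fL KL hdeg; apply: mpoly_meval_inj => v.
(* [v] is indexed by the variables; [t] extends it by 0 to all sets. *)
pose t F := if insub F is Some u then v (enum_rank (u : btw M K L)) else 0.
have vE : v =1 fun i => t (btw_set i).
  by move=> i; rewrite /t /btw_set valK enum_valK.
rewrite !(meval_eq _ vE) meval_vol // -/(pol_at M K L t).
have lH := dhomogMn (flat_d M K L) (@lform_homog R E M K L t).
rewrite mul1n in lH; rewrite -top_degree_homog //.
(* Here [c = 1], and the factorial cancels the one in [vol]. *)
rewrite (scalar_lform_exp_flat_d (phi := top_degree deg) _ (leqnn _) fK fL KL
  (top_degree_kills hdeg) (top_degree_flag hdeg)).
by rewrite mul1r mulKf // pnatr_eq0 -lt0n fact_gt0.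
Qed.
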